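(* Let $q$ be a prime power. Consider $\ell$-interleaved random codes over $\mathbb{F}_q$ of length $n$ and dimension $k=k(n)$, with $t=t(n)$ error columns and interleaving order $\ell=\ell(n)$, such that $$R=\lim_{n\to\infty}\frac{k(n)}{n},\qquad T=\lim_{n\to\infty}\frac{t(n)}{n}=H_q^{-1}(1-R),\qquad L=\lim_{n\to\infty}\frac{\ell(n)}{n}=\frac{T}{\gamma}$$ for some positive integer $\gamma>2$. Then the asymptotic complexity of Interleaved Prange is at most $q^{n e(R,q)}$, where $$e(R,q)=H(1,R+L)-H(1-T,R)-H(T,L)+\min\{H(R+L,R),\,L\}.$$
   Context: Notation: $H_q(x)=x\log_q(q-1)-x\log_q x-(1-x)\log_q(1-x)$ is the $q$-ary entropy function and $H_q^{-1}$ its inverse on $[0,1-1/q]$. For $0\le G\le F$, $$H(F,G)=F\log_q F-G\log_q G-(F-G)\log_q(F-G)=\lim_{n\to\infty}\frac1n\log_q\binom{f(n)}{g(n)}$$ for integer-valued $f,g$ with $f(n)/n\to F$, $g(n)/n\to G$. ''Asymptotic complexity at most $q^{ne(R,q)}$'' means that $\lim_{n\to\infty}\frac1n\log_q(\text{cost})\le e(R,q)$. Given a linear code with generator matrix $\mathbf{G}\in\mathbb{F}_q^{k\times n}$, its (homogeneous) $\ell$-interleaved code is $\{\mathbf{M}\mathbf{G} : \mathbf{M}\in\mathbb{F}_q^{\ell\times k}\}$. For $\mathcal{J}\subseteq[1,n]$, $\mathbf{X}_{\mathcal{J}}$ is the submatrix of columns of $\mathbf{X}$ indexed by $\mathcal{J}$;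 $\mathrm{wt}$ is Hamming weight and $\mathrm{supp}$ is the set of indices of non-zero entries of a vector (of non-zero columns of a matrix). Random instance: $\mathbf{G}\in\mathbb{F}_q^{k\times n}$ and $\mathcal{T}\subseteq[1,n]$ of size $t$ are chosen uniformly at random; $\mathbf{E}\in\mathbb{F}_q^{\ell\times n}$ is zero outside the columns in $\mathcal{T}$ and $\mathbf{E}_{\mathcal{T}}$ is uniformly random in $\mathbb{F}_q^{\ell\times t}$; $\mathbf{M}\in\mathbb{F}_q^{\ell\times k}$ is uniformly random; the received matrix is $\mathbf{R}=\mathbf{M}\mathbf{G}+\mathbf{E}$. Algorithm Interleaved Prange (input $\mathbf{G},\mathbf{R}$; output a nonempty subset of $\mathrm{supp}(\mathbf{E})$). Put $\mathbf{G}'=\begin{bmatrix}\mathbf{G}\\ \mathbf{R}\end{bmatrix}$. Iterate: (1) choose (at random) $\mathcal{J}\subset[1,n]$ of size $k+\ell$ with $\mathrm{rk}(\mathbf{G}_{\mathcal{J}})=k$; (2) if $\mathrm{rk}(\mathbf{G}'_{\mathcal{J}})<k+\ell$, then for each non-zero $\mathbf{x}\in\mathbb{F}_q^{k+\ell}$ with $\mathbf{x}\mathbf{G}'_{\mathcal{J}}=\mathbf{0}$, if $\mathrm{wt}(\mathbf{x}\mathbf{G}')\le t$ return $\mathrm{supp}(\mathbf{x}\mathbf{G}')$; (3) otherwise go back to (1). The cost of Interleaved Prange is in $\mathcal{O}(P^{-1}C)$, where $$P=\sum_{i=0}^{\min\{t,k+\ell\}}\frac{\binom{n-t}{k+\ell-i}\binom{t}{i}}{\binom{n}{k+\ell}}\left(1-\prod_{j=0}^{\ell-1}(1-q^{j-i})\right)$$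 is the success probability of one iteration and $$C=(k+\ell)^3+\left(\prod_{j=0}^{k-1}(1-q^{j-k})\right)16\left(\sum_{p=1}^{\ell}q^{-p^2+p}\right)(k+\ell)(n-k-\ell)$$ is the cost of one iteration. *)

(* Defs.v *)
From mathcomp Require Import all_boot all_order all_algebra.
From mathcomp Require Import all_classical all_reals all_analysis.

Set Implicit Arguments.
Unset Strict Implicit.
Unset Printing Implicit Defensive.

Import Order.TTheory GRing.Theory Num.Theory.
Import numFieldNormedType.Exports.

Local Open Scope classical_set_scope.
Local Open Scope ring_scope.

Definition prime_power (q : nat) : Prop :=
  exists p m : nat, [/\ prime p, (0 < m)%N & q = (p ^ m)%N].

(* Since [ln 0 = 0], the convention [0 * log_q 0 = 0] holds in all the entropy
   expressions below. *)
Definition logq {K : realType} (q : nat) (x : K) : K := ln x / ln q%:R.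

Definition Hq {K : realType} (q : nat) (x : K) : K :=
  x * logq q (q%:R - 1) - x * logq q x - (1 - x) * logq q (1 - x).

(* Partial inverse on [[0, 1 - 1/q]]; the default value of [pinv] is only
   reached for arguments outside [[0, 1]]. *)
Definition Hq_inv {K : realType} (q : nat) : K -> K :=
  pinv (`[0, 1 - q%:R^-1] : set K) (Hq q).

Definition Hbin {K : realType} (q : nat) (F G : K) : K :=
  F * logq q F - G * logq q G - (F - G) * logq q (F - G).

(* The success probability of one iteration and the cost of one iteration of
   Interleaved Prange for length [n], dimension [k], [t] error columns and
   interleaving order [l]; the exponents of [q] are integers, possibly
   negative. The binomials are the intended ones when [t <= n] and
   [k + l <= n]. *)
Definition prange_success {K : realType} (q n k t l : nat) : K :=
  \sum_(0 <= i < (minn t (k + l)).+1)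
    ('C(n - t, k + l - i) * 'C(t, i))%:R / ('C(n, k + l))%:R *
    (1 - \prod_(0 <= j < l) (1 - q%:R ^ (j%:Z - i%:Z))).

Definition prange_iteration_cost {K : realType} (q n k l : nat) : K :=
  (k + l)%:R ^+ 3 +
  (\prod_(0 <= j < k) (1 - q%:R ^ (j%:Z - k%:Z))) *
  (16%:R * (\sum_(1 <= p < l.+1) q%:R ^ (p%:Z - (p%:Z) ^+ 2)) *
   (k + l)%:R * (n%:R - k%:R - l%:R)).

(* "Asymptotic complexity at most q^(n e)": as a cost known only up to an
   upper bound need not make [log_q (cost n) / n] converge, the limit is the
   limit superior. *)
Definition asymptotic_complexity_le {K : realType} (q : nat)
    (cost : nat -> K) (e : K) : Prop :=
  (limn_esup (fun n => (n%:R^-1 * logq q (cost n))%:E) <= e%:E)%E.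

Definition prange_exponent {K : realType} (q : nat) (R T L : K) : K :=
  Hbin q 1 (R + L) - Hbin q (1 - T) R - Hbin q T L
    + Num.min (Hbin q (R + L) R) L.

(* Main.v *)
(* The iteration cost is polynomial in n, so only the success probability P
   matters. If T > 0, then H_q(x) > x on (0, 1 - 1/q] gives R < 1 - T, and L < T,
   so the single term i = l of P is available; its rank factor is at least 1/q,
   hence P >= C(n-t,k) C(t,l) / (q C(n,k+l)), whose exponential rate is
   -(H(1,R+L) - H(1-T,R) - H(T,L)). If T = 0, then R = 1, L = 0 and this rate
   is 0, but the term i = l may vanish; instead every rank factor is at least
   q^(-t), so P >= q^(-t) = q^(-o(n)) by Vandermonde's identity. In both cases
   the bound holds without the nonnegative summand min(H(R+L,R), L). *)
Require Import Defs.
From mathcomp Require Import all_boot all_order all_algebra.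
From mathcomp Require Import all_classical all_reals all_analysis.
From mathcomp Require Import ring lra.

Set Implicit Arguments.
Unset Strict Implicit.
Unset Printing Implicit Defensive.

Import Order.TTheory GRing.Theory Num.Theory.
Import numFieldNormedType.Exports.

Local Open Scope classical_set_scope.
Local Open Scope ring_scope.

(** * Continuity of [x ln x], including at 0 *)

(** For [x > 0], put [s = sqrt x]: the inequality [ln y < y] at [y = 1/s] gives [s ln s > -1], and
    [x ln x = 2 s (s ln s)]. This is the lower barrier for the squeeze at 0. *)
Lemma xlnx_ge (K : realType) (x : K) : - (2 * Num.sqrt `|x|) <= x * ln x.
Proof.
have [x0|x0] := leP x 0.
  by rewrite (ln0 x0) mulr0 oppr_le0 mulr_ge0// sqrtr_ge0.
have s0 : 0 < Num.sqrt x by rewrite sqrtr_gt0.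
have xE : x = Num.sqrt x ^+ 2 by rewrite sqr_sqrtr// ltW.
rewrite gtr0_norm// {2 3}xE lnXn//.
have sV0 : 0 < (Num.sqrt x)^-1 by rewrite invr_gt0.
have := ln_sublinear sV0; rewrite lnV ?posrE// => h.
have {}h : - 1 < Num.sqrt x * ln (Num.sqrt x).
  rewrite -(ltr_pM2l s0) mulfV ?gt_eqF// in h.
  by rewrite ltrNl -mulrN.
move: (Num.sqrt x) (ln _) s0 h => s y s0 h.
nra.
Qed.

Lemma continuous_xlnx (K : realType) : continuous (fun x : K => x * ln x).
Proof.
move=> x; have [x0|x0|->] := ltgtP x 0.
- rewrite /continuous_at (ln0 (ltW x0)) mulr0.
  apply: cvg_near_cst; near=> y; rewrite ln0 ?mulr0//.
  by apply/ltW; near: y; exact: lt_nbhsl.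
- by apply: cvgM; [exact: cvg_id|exact: continuous_ln].
(* At 0 the function is squeezed between [-2 sqrt |y|] and 0; for [y <= 0] it vanishes because
   [ln y = 0] there. *)
rewrite /continuous_at mul0r.
apply: (@squeeze_cvgr _ _ _ _ (fun y : K => - (2 * Num.sqrt `|y|))
  (fun=> 0)); last exact: cvg_cst.
- near=> y; rewrite xlnx_ge/=.
  have [y0|y0] := leP y 0; first by rewrite ln0// mulr0.
  rewrite mulr_ge0_le0// ?(ltW y0)// ln_le0//.
  by apply/ltW; near: y; exact: lt_nbhsl.
- suff h : (fun y : K => 2 * Num.sqrt `|y|) @ (0 : K) --> 2 * Num.sqrt `|0 : K|.
    rewrite normr0 sqrtr0 mulr0 in h.
    by have h2 := cvgN h; rewrite oppr0 in h2; exact: h2.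
  apply: cvgM; first exact: cvg_cst.
  apply: (@continuous_cvg _ _ _ _ _ (fun y : K => `|y|)
    (@Num.sqrt K) `|0|); first exact: sqrt_continuous.
  exact: norm_continuous.
Unshelve. all: by end_near. Qed.

(** * Growth rates of factorials and binomial coefficients *)

(** Induction on [n] with [ln (1 + x) <= x]: the step from [n] to [n + 1] takes [x = 1/n] for the
    lower bound (when [n > 0]) and [x = -1/(n+2)] for the upper one. *)
Lemma ln_fact_bounds (K : realType) (n : nat) :
  n%:R * ln (n%:R : K) - n%:R <= ln (n`!%:R) <=
  n.+1%:R * ln (n.+1%:R : K) - n%:R.
Proof.
elim: n => [|n /andP[IH1 IH2]].
  by rewrite fact0 !ln1 mulr0 mul0r subr0 lexx.
have n1 : 0 < n.+1%:R :> K by [].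
have n2 : 0 < n.+2%:R :> K by [].
rewrite factS natrM lnM ?posrE// ?ltr0n ?fact_gt0//.
apply/andP; split.
  have h : n%:R * (ln (n.+1%:R : K) - ln n%:R) <= 1.
    case: n {IH1 IH2 n1 n2} => [|n]; first by rewrite mul0r.
    have n1 : 0 < n.+1%:R :> K by [].
    rewrite -ln_div ?posrE// mulrC -ler_pdivlMr// mul1r.
    have -> : n.+2%:R / n.+1%:R = 1 + n.+1%:R^-1 :> K.
      by rewrite -addn1 natrD mulrDl mulfV ?gt_eqF// mul1r.
    by apply: le_ln1Dx; rewrite (lt_trans (ltrN10 _))// invr_gt0.
  rewrite -natr1 in h *; lra.
have h : 1 <= n.+2%:R * (ln (n.+2%:R : K) - ln n.+1%:R).
  rewrite mulrC -ler_pdivrMr// -lerN2 opprB -ln_div ?posrE//.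
  have -> : n.+1%:R / n.+2%:R = 1 + - n.+2%:R^-1 :> K.
    by rewrite -[n.+2]addn1 natrD; field; rewrite gt_eqF// -natr1 natr1.
  rewrite mul1r; apply: le_ln1Dx; rewrite ltrN2 invf_lt1//.
  by rewrite ltr1n.
rewrite -[n.+2%:R]natr1 -[n.+1%:R]natr1 in h IH2 *; lra.
Qed.

Lemma cvg_invn (K : realType) : (fun n => n%:R^-1 : K) @ \oo --> (0 : K).
Proof.
by rewrite -(cvg_shiftS (fun n => n%:R^-1 : K)); exact: cvg_harmonic.
Qed.

Lemma cvg_ln_fact (K : realType) (f : nat -> nat) (F : K) :
  (fun n => (f n)%:R / n%:R : K) @ \oo --> F ->
  (fun n => n%:R^-1 * ln ((f n)`!%:R : K) - (f n)%:R / n%:R * (ln n%:R - 1))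
    @ \oo --> F * ln F.
Proof.
move=> hF.
have hV := @cvg_invn K; pose h (x : K) := x * ln x.
have hc x : {for x, continuous h} by exact: continuous_xlnx.
(* With [h x := x ln x], the crude bounds on [ln (f!)] differ by [h] evaluated
   at points [1/n] apart, up to [ln n / n = - h (1/n)]; continuity of [h] thus
   replaces Stirling's formula. *)
apply: (@squeeze_cvgr _ _ _ _ (fun n => h ((f n)%:R / n%:R))
  (fun n => h ((f n)%:R / n%:R + n%:R^-1) - h n%:R^-1)).
- near=> n.
  have n0 : 0 < n%:R :> K by rewrite ltr0n; near: n; exact: nbhs_infty_gt.
  have nV0 : 0 < n%:R^-1 :> K by rewrite invr_gt0.
  have hs (m : nat) : h (m%:R / n%:R) =
      n%:R^-1 * (m%:R * ln (m%:R : K)) - m%:R / n%:R * ln n%:R.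
    rewrite /h; case: m => [|m]; first by rewrite !mul0r mulr0 subr0.
    by rewrite ln_div ?posrE// mulrBr; congr (_ - _); ring.
  have -> : (f n)%:R / n%:R + n%:R^-1 = (f n).+1%:R / n%:R :> K.
    by rewrite -natr1 mulrDl mul1r.
  have -> : h n%:R^-1 = - (n%:R^-1 * ln n%:R).
    by rewrite /h lnV ?posrE// mulrN.
  rewrite !hs.
  have /andP[l1 l2] := ln_fact_bounds K (f n).
  rewrite -(ler_pM2l nV0) in l1; rewrite -(ler_pM2l nV0) in l2.
  rewrite mulrBr in l1; rewrite mulrBr in l2.
  apply/andP; split.
    rewrite [_ / _ * (_ - _)]mulrBr mulr1 [_ / _]mulrC; lra.
  have -> : (f n).+1%:R / n%:R * ln n%:R =
     (f n)%:R / n%:R * ln n%:R + n%:R^-1 * ln n%:R :> K.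
    by rewrite -natr1; ring.
  rewrite [_ / _ * (_ - _)]mulrBr mulr1 [_ / _]mulrC; lra.
- exact: continuous_cvg hF.
- have -> : F * ln F = h (F + 0) - h 0 by rewrite addr0 /h mul0r subr0.
  apply: cvgB; last exact: continuous_cvg hV.
  apply: (@continuous_cvg _ _ _ _ _ _ h); first exact: hc.
  exact: cvgD.
Unshelve. all: by end_near. Qed.

(** The correction [f n / n * (ln n - 1)] in [cvg_ln_fact] is additive in [f], so it cancels between
    the factorials of [f], [g] and [f - g]. *)
Lemma cvg_logq_bin (K : realType) (q : nat) (f g : nat -> nat) (F G : K) :
  (\forall n \near \oo, (g n <= f n)%N) ->
  (fun n => (f n)%:R / n%:R : K) @ \oo --> F ->
  (fun n => (g n)%:R / n%:R : K) @ \oo --> G ->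
  (fun n => n%:R^-1 * logq q ('C(f n, g n)%:R : K)) @ \oo --> Hbin q F G.
Proof.
move=> gf hF hG.
have hFG : (fun n => (f n - g n)%:R / n%:R : K) @ \oo --> F - G.
  apply: cvg_trans (cvgB hF hG); apply: near_eq_cvg; near=> n.
  by rewrite natrB ?mulrBl//; near: n.
have -> : Hbin q F G =
    (F * ln F - G * ln G - (F - G) * ln (F - G)) / ln q%:R.
  by rewrite /Hbin /logq; ring.
apply: cvg_trans (cvgM (cvgB (cvgB (cvg_ln_fact hF) (cvg_ln_fact hG))
  (cvg_ln_fact hFG)) (cvg_cst (ln q%:R)^-1)).
apply: near_eq_cvg; near=> n; rewrite !fctE /logq.
have le_gf : (g n <= f n)%N by near: n.
rewrite /= -(bin_fact le_gf) !natrM !lnM ?posrE ?mulr_gt0 ?ltr0n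
  ?fact_gt0 ?bin_gt0// natrB//; ring.
Unshelve. all: by end_near. Qed.

(** By monotonicity of [ln], [x ln x <= x ln F] for [0 <= x <= F]; the cases [x = G] and [x = F - G]
    add up to [F ln F]. *)
Lemma Hbin_ge0 (K : realType) (q : nat) (F G : K) :
  (1 < q)%N -> 0 <= G <= F -> 0 <= Hbin q F G.
Proof.
move=> q1 /andP[G0 GF].
have lq : 0 < ln (q%:R : K) by rewrite ln_gt0 // ltr1n.
have mono (x : K) : 0 <= x <= F -> x * ln x <= x * ln F.
  move=> /andP[]; rewrite le_eqVlt => /predU1P[<-|x0 xF].
    by rewrite !mul0r.
  by rewrite ler_pM2l// ler_ln ?posrE// (lt_le_trans x0).
rewrite (_ : Hbin q F G = (F * ln F - G * ln G
    - (F - G) * ln (F - G)) / ln q%:R); last by rewrite /Hbin /logq; ring.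
apply: divr_ge0; last exact: ltW.
have h1 := mono G; have h2 := mono (F - G).
rewrite G0 GF in h1; rewrite subr_ge0 GF gerBl G0 in h2.
have := h1 isT; have := h2 isT; lra.
Qed.

(** * Limits superior *)

Lemma limn_esup_le (K : realType) (u v : nat -> K) (e : K) :
  (\forall n \near \oo, u n <= v n) -> v @ \oo --> e ->
  (limn_esup (EFin \o u) <= e%:E)%E.
Proof.
move=> uv ve; apply/lee_addgt0Pr => d d0.
rewrite /limn_esup limf_esupE.
have near_u : \forall n \near \oo, u n <= e + d.
  near=> n; apply: (@le_trans _ _ (v n)); first by near: n.
  by near: n; apply: cvgr_le ve _ _; rewrite ltrDl.
(* The limit superior is an infimum, over the sets of the filter, of suprema; the set where
   [u n <= e + d] is one of them. *)
apply: (@le_trans _ _ (ereal_sup [set (EFin \o u) x | x in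
    [set n | u n <= e + d]])).
  by apply: ereal_inf_lbound; exists [set n | u n <= e + d].
by apply: ge_ereal_sup => _ [n /= un <-]; rewrite -EFinD lee_fin.
Unshelve. all: by end_near. Qed.

(** * Rank factors and lower bounds for the success probability *)

Lemma exprz_subn_nat (F : fieldType) (x : F) (i j : nat) : (j <= i)%N ->
  x ^ (j%:Z - i%:Z) = (x ^+ (i - j))^-1.
Proof. by move=> ji; rewrite -opprB subzn// -exprz_inv -exprnP exprVn. Qed.

Lemma exprz_subn_itv (K : realFieldType) (x : K) (i j : nat) :
  1 <= x -> (j <= i)%N -> 0 < x ^ (j%:Z - i%:Z) <= 1.
Proof.
move=> x1 ji; rewrite exprz_subn_nat// invr_gt0 exprn_gt0 ?(lt_le_trans _ x1)//.
by rewrite invf_le1 ?exprn_gt0 ?(lt_le_trans _ x1)// exprn_ege1.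
Qed.

Lemma prod_1Bexprz_itv (K : realFieldType) (x : K) (k i : nat) (P : pred nat) :
  1 <= x -> (k <= i)%N ->
  0 <= \prod_(0 <= j < k | P j) (1 - x ^ (j%:Z - i%:Z)) <= 1.
Proof.
move=> x1 ki.
have F01 j : (j < k)%N -> 0 <= 1 - x ^ (j%:Z - i%:Z) <= 1.
  move=> jk; have /andP[h1 h2] := exprz_subn_itv x1 (leq_trans (ltnW jk) ki).
  by rewrite subr_ge0 h2 gerBl ltW.
rewrite big_mkord prodr_ge0 ?prodr_ile1// => [j _|j _]; first exact: F01.
by have /andP[] := F01 _ (ltn_ord j).
Qed.

(* The right-hand side is the probability that a uniformly random [i x l]
   matrix over the field with [x] elements has dependent columns; column [j0]
   lies in a given subspace of dimension [j0] with probability [x^(j0-i)]. *)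
Lemma one_sub_prod_ge (K : realFieldType) (x : K) (l i j0 : nat) :
  1 <= x -> (j0 < l)%N -> (j0 <= i)%N ->
  x ^ (j0%:Z - i%:Z) <= 1 - \prod_(0 <= j < l) (1 - x ^ (j%:Z - i%:Z)).
Proof.
move=> x1 j0l j0i; have [il|li] := ltnP i l.
  (* If [i < l], the factor [j = i] is 0 and the right-hand side is 1. Otherwise the factor [j0] is
     isolated and the remaining product is at most 1. *)
  rewrite (bigD1_seq i) ?mem_index_iota ?iota_uniq//= subrr expr0z subrr.
  by rewrite mul0r subr0; have /andP[] := exprz_subn_itv x1 j0i.
rewrite (bigD1_seq j0) ?mem_index_iota ?iota_uniq//= lerBrDr -lerBrDl.
have /andP[p0 p1] := prod_1Bexprz_itv (fun j => j != j0) x1 li.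
rewrite ler_piMr// subr_ge0.
by have /andP[] := exprz_subn_itv x1 j0i.
Qed.

Lemma prange_success_term_ge0 (K : realType) (q n k t l i : nat) :
  (0 < q)%N -> (0 < l)%N ->
  0 <= ('C(n - t, k + l - i) * 'C(t, i))%:R / ('C(n, k + l))%:R *
    (1 - \prod_(0 <= j < l) (1 - q%:R ^ (j%:Z - i%:Z))) :> K.
Proof.
move=> q0 l0; apply: mulr_ge0; first by rewrite divr_ge0.
apply: le_trans (_ : _ <= q%:R ^ (0%:Z - i%:Z)) _.
  by rewrite exprz_ge0.
by apply: one_sub_prod_ge; rewrite ?ler1n.
Qed.

(** The hypergeometric weights sum to 1, and each rank factor is at least [q^(-i) >= q^(-t)], by
    [one_sub_prod_ge] with [j0 = 0]. *)
Lemma prange_success_ge_qt (K : realType) (q n k t l : nat) :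
  (0 < q)%N -> (0 < l)%N -> (k + l <= n)%N -> (t <= n)%N ->
  (q%:R ^+ t)^-1 <= prange_success q n k t l :> K.
Proof.
move=> q0 l0 kln tn; have q1 : 1 <= q%:R :> K by rewrite ler1n.
have C0 : 0 < 'C(n, k + l)%:R :> K by rewrite ltr0n bin_gt0.
have V : \sum_(0 <= i < (minn t (k + l)).+1)
    ('C(n - t, k + l - i) * 'C(t, i))%:R = 'C(n, k + l)%:R :> K.
  rewrite -natr_sum; congr _%:R.
  rewrite -{2}(subnKC tn) -binomial.Vandermonde -(big_mkord xpredT
    (fun j => 'C(t, j) * 'C(n - t, k + l - j)))%N.
  (* Vandermonde's sum runs up to [k + l]; the terms beyond [minn t (k + l)] have [i > t], so
     ['C(t, i) = 0]. *)
  rewrite [RHS](@big_cat_nat _ _ _ (minn t (k + l)).+1)//=; last first.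
    by rewrite ltnS geq_minr.
  rewrite [X in _ = (_ + X)%N]big_nat_cond [X in _ = (_ + X)%N]big1.
    by rewrite addn0; apply: eq_bigr => i _; rewrite mulnC.
  move=> i; rewrite andbT => /andP[h1 h2]; rewrite (@bin_small t)//.
  by move: h1 h2; rewrite gtn_min !ltnS => /orP[//|]; rewrite ltnNge => /negP.
have -> : (q%:R ^+ t)^-1 = \sum_(0 <= i < (minn t (k + l)).+1)
    ('C(n - t, k + l - i) * 'C(t, i))%:R / 'C(n, k + l)%:R
      * (q%:R ^+ t)^-1 :> K.
  by rewrite -!mulr_suml V divff ?mul1r// gt_eqF.
apply: ler_sum_nat => i /andP[_]; rewrite ltnS leq_min => /andP[it _].
apply: ler_wpM2l; first by rewrite divr_ge0.
apply: le_trans (one_sub_prod_ge q1 l0 (leq0n i)).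
rewrite exprz_subn_nat// subn0 lef_pV2 ?posrE ?exprn_gt0 ?ltr0n//.
by rewrite ler_weXn2l.
Qed.

Lemma prange_success_ge_term (K : realType) (q n k t l : nat) :
  (0 < q)%N -> (0 < l)%N -> (l <= t)%N ->
  ('C(n - t, k) * 'C(t, l))%:R / ('C(n, k + l))%:R / q%:R <=
  prange_success q n k t l :> K.
Proof.
move=> q0 l0 lt; rewrite /prange_success.
rewrite (bigD1_seq l) ?iota_uniq ?mem_index_iota//=; last first.
  by rewrite ltnS leq_min lt leq_addl.
rewrite addnK -[leLHS]addr0; apply: lerD; last first.
  by apply: sumr_ge0 => i _; exact: prange_success_term_ge0.
apply: ler_wpM2l; first by rewrite divr_ge0.
(* With [i = l], the choice [j0 = l - 1] bounds the rank factor below by [q^(-1)]. *)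
have l1 : (l.-1 < l)%N by rewrite prednK.
have q1 : 1 <= q%:R :> K by rewrite ler1n.
apply: le_trans (one_sub_prod_ge q1 l1 (leq_pred l)).
by rewrite exprz_subn_nat ?leq_pred// -subn1 subKn// expr1.
Qed.

(** * Polynomial bound on the cost of one iteration *)

(** Here [17 = 1 + 16]: the product over [j] is at most 1, and each of [k + l], [n - k - l] and the
    sum over [p] is at most [n]. *)
Lemma prange_iteration_cost_itv (K : realType) (q n k l : nat) :
  (0 < q)%N -> (0 < l)%N -> (k + l <= n)%N ->
  0 < (prange_iteration_cost q n k l : K) <= 17%:R * n%:R ^+ 3.
Proof.
move=> q0 l0 kln; have q1 : 1 <= q%:R :> K by rewrite ler1n.
rewrite /prange_iteration_cost.
have /andP[p0 p1] := prod_1Bexprz_itv xpredT q1 (leqnn k).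
set p := \prod_(_ <= _ < _) _ in p0 p1 *.
have s01 : 0 <= \sum_(1 <= p < l.+1) (q%:R : K) ^ (p%:Z - p%:Z ^+ 2) <= l%:R.
  (* Since [i <= i^2], each summand is at most 1, hence the sum is at most [l]. *)
  have e01 (i : nat) : 0 < (q%:R : K) ^ (i%:Z - i%:Z ^+ 2) <= 1.
    have -> : i%:Z ^+ 2 = (i ^ 2)%:Z by rewrite expr2 -PoszM mulnn.
    by apply: exprz_subn_itv => //; case: i => // i; rewrite -mulnn leq_pmulr.
  apply/andP; split.
    by apply: sumr_ge0 => i _; have /andP[/ltW] := e01 i.
  rewrite (_ : l%:R = \sum_(1 <= p < l.+1) 1); last first.
    by rewrite sumr_const_nat subn1.
  by apply: ler_sum => i _; have /andP[] := e01 i.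
set s := \sum_(_ <= _ < _) _ in s01 *.
have /andP[s0 sl] := s01.
have kl0 : 0 < (k + l)%:R :> K by rewrite ltr0n addn_gt0 l0 orbT.
have kln' : (k + l)%:R <= n%:R :> K by rewrite ler_nat.
have ln : l%:R <= n%:R :> K.
  by rewrite ler_nat (leq_trans _ kln)// leq_addl.
have d0 : 0 <= n%:R - k%:R - l%:R :> K.
  by rewrite -addrA -opprD -natrD subr_ge0.
have dn : n%:R - k%:R - l%:R <= n%:R :> K.
  by rewrite -addrA gerDl -opprD oppr_le0 -natrD.
apply/andP; split.
  by rewrite ltr_wpDr ?exprn_gt0// !mulr_ge0// ltW.
rewrite (_ : 17%:R * n%:R ^+ 3 =
  n%:R ^+ 3 + 1 * (16%:R * n%:R * n%:R * n%:R)); last by ring.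
apply: lerD; first by rewrite lerXn2r ?nnegrE// ltW.
apply: ler_pM => //; first by rewrite !mulr_ge0// ltW.
apply: ler_pM => //; first by rewrite !mulr_ge0// ltW.
apply: ler_pM => //; first by rewrite mulr_ge0.
by apply: ler_pM => //; exact: le_trans sl ln.
Qed.

(** * From a bound on the success probability to the exponent *)

(** This is [-x ln x] at [x = 1/n], so continuity at 0 gives the limit. *)
Lemma cvg_lnn_div (K : realType) :
  (fun n => n%:R^-1 * ln (n%:R : K)) @ \oo --> (0 : K).
Proof.
have h : (fun n => n%:R^-1 * ln (n%:R^-1 : K)) @ \oo --> (0 * ln 0 : K).
  apply: (@continuous_cvg nat K K \oo _ (fun n => n%:R^-1)
    (fun x => x * ln x) 0).
    exact: continuous_xlnx.
  exact: cvg_invn.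
rewrite (_ : (0 : K) = - (0 * ln 0)); last by rewrite mul0r oppr0.
apply: cvg_trans (cvgN h); apply: near_eq_cvg; near=> n.
have n0 : 0 < n%:R :> K by rewrite ltr0n; near: n; exact: nbhs_infty_gt.
by rewrite fctE /= lnV ?posrE// mulrN opprK.
Unshelve. all: by end_near. Qed.

(** Reduces both cases of the theorem to a lower bound [B] on the success probability with rate
    [-e]: then [cost n <= 17 c n^3 / B n] eventually, and after taking [log_q] and dividing by [n]
    only [B] contributes to the limit. *)
Lemma prange_complexity_le (K : realType) (q : nat) (k t l : nat -> nat)
    (cost B : nat -> K) (e : K) :
  (1 < q)%N ->
  (\forall n \near \oo, [/\ (0 < l n)%N, (k n + l n <= n)%N & (t n <= n)%N]) ->
  (\forall n \near \oo, 0 < cost n) ->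
  cost =O_\oo (fun n => (prange_success q n (k n) (t n) (l n))^-1
    * prange_iteration_cost q n (k n) (l n)) ->
  (\forall n \near \oo, 0 < B n <= prange_success q n (k n) (t n) (l n)) ->
  (fun n => n%:R^-1 * logq q (B n)) @ \oo --> - e ->
  asymptotic_complexity_le q cost e.
Proof.
move=> q1 hparam hcost0 /eqO_exP[c c0 hc] hB hlim.
have lq : 0 < ln (q%:R : K) by rewrite ln_gt0 // ltr1n.
apply: (@limn_esup_le _ _ (fun n => (n%:R^-1 * ln (17%:R * c)
  + 3%:R * (n%:R^-1 * ln n%:R)) / ln q%:R - n%:R^-1 * logq q (B n))).
  near=> n.
  have n0 : 0 < n%:R :> K by rewrite ltr0n; near: n; exact: nbhs_infty_gt.
  have [l0 kln tn] : [/\ (0 < l n)%N, (k n + l n <= n)%N & (t n <= n)%N].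
    by near: n.
  have cn0 : 0 < cost n by near: n.
  have /andP[B0 BP] : 0 < B n <= prange_success q n (k n) (t n) (l n).
    by near: n.
  have /andP[C0 C17] := prange_iteration_cost_itv K (ltnW q1) l0 kln.
  have P0 := lt_le_trans B0 BP.
  have : cost n <= c * ((B n)^-1 * (17%:R * n%:R ^+ 3)).
    rewrite -[cost n]gtr0_norm//.
    apply: (@le_trans _ _ (c * `|(prange_success q n (k n) (t n) (l n))^-1
      * prange_iteration_cost q n (k n) (l n)|)); first by near: n.
    rewrite ger0_norm; last by apply: mulr_ge0; rewrite ?invr_ge0 ltW.
    apply: ler_wpM2l; first exact: ltW.
    apply: ler_pM => //; [by rewrite invr_ge0 ltW|exact: ltW|].
    by rewrite lef_pV2.
  rewrite -ler_ln ?posrE ?mulr_gt0 ?invr_gt0 ?exprn_gt0//.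
  have -> : c * ((B n)^-1 * (17%:R * n%:R ^+ 3))
      = 17%:R * c * n%:R ^+ 3 / B n by ring.
  rewrite ln_div ?posrE ?mulr_gt0 ?exprn_gt0//.
  rewrite lnM ?posrE ?mulr_gt0 ?exprn_gt0// lnXn// => h.
  rewrite /logq (_ : _ - _ = n%:R^-1 *
    ((ln (17%:R * c) + ln n%:R *+ 3 - ln (B n)) / ln q%:R)).
    apply: ler_wpM2l; first by rewrite invr_ge0 ltW.
    by apply: ler_wpM2r => //; rewrite invr_ge0 ltW.
  by rewrite -mulr_natl; ring.
have -> : e = (0 * ln (17%:R * c) + 3%:R * 0) / ln q%:R - - e.
  by rewrite mul0r mulr0 addr0 mul0r opprK add0r.
apply: cvgB hlim; apply: cvgM; last exact: cvg_cst.
apply: cvgD; first by apply: cvgM; [exact: cvg_invn|exact: cvg_cst].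
by apply: cvgM; [exact: cvg_cst|exact: cvg_lnn_div].
Unshelve. all: by end_near. Qed.

(** * The q-ary entropy function and its inverse *)

Lemma continuous_Hq (K : realType) (q : nat) : continuous (@Hq K q).
Proof.
rewrite (_ : Hq q = fun x : K => x * logq q (q%:R - 1)
    - x * ln x * (ln q%:R)^-1 - (1 - x) * ln (1 - x) * (ln q%:R)^-1);
    last first.
  by apply/funext => x; rewrite /Hq /logq; ring.
move=> x; apply: cvgB; [apply: cvgB|]; (apply: cvgM; last exact: cvg_cst).
- exact: cvg_id.
- exact: continuous_xlnx.
apply: (@continuous_cvg _ _ _ _ _ (fun y : K => 1 - y) (fun y => y * ln y)).
  exact: continuous_xlnx.
by apply: cvgB; [exact: cvg_cst|exact: cvg_id].
Qed.

Lemma Hq0 (K : realType) (q : nat) : Hq q 0 = 0 :> K.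
Proof. by rewrite /Hq /logq subr0 ln1 !mul0r mulr0 !subr0. Qed.

Lemma Hq_1BVq (K : realType) (q : nat) : (1 < q)%N ->
  Hq q (1 - q%:R^-1) = 1 :> K.
Proof.
move=> q1; have q1' : 1 < q%:R :> K by rewrite ltr1n.
have q0 : 0 < q%:R :> K by rewrite (lt_trans _ q1').
have lq : 0 < ln (q%:R : K) by rewrite ln_gt0.
have -> : 1 - q%:R^-1 = (q%:R - 1) / q%:R :> K.
  by field; rewrite gt_eqF.
rewrite /Hq /logq ln_div ?posrE ?subr_gt0//.
have -> : 1 - (q%:R - 1) / q%:R = q%:R^-1 :> K by field; rewrite gt_eqF.
by rewrite lnV ?posrE//; field; rewrite !gt_eqF.
Qed.

(** [Hq] is continuous with value 0 at 0 and 1 at [1 - 1/q], so [y] is attained by the intermediate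
    value theorem and [pinv] returns a genuine preimage. *)
Lemma Hq_invP (K : realType) (q : nat) (y : K) : (1 < q)%N -> 0 <= y <= 1 ->
  0 <= Hq_inv q y <= 1 - q%:R^-1 /\ Hq q (Hq_inv q y) = y.
Proof.
move=> q1 y01; have q1' : 1 < q%:R :> K by rewrite ltr1n.
have yim : (Hq q @` (`[0, 1 - q%:R^-1] : set K)) y.
  have [|||x xI <-] := @IVT K (Hq q) 0 (1 - q%:R^-1) y.
  - by rewrite subr_ge0 invf_le1 ?ltW// (lt_trans _ q1').
  - by apply: continuous_subspaceT; exact: continuous_Hq.
  - by rewrite Hq0 Hq_1BVq// min_l// max_r.
  by exists x.
split; last by rewrite /Hq_inv pinvK// inE.
have : [set` `[0, 1 - q%:R^-1]] (Hq_inv q y).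
  by apply: (@surjpinv_image_sub _ _ _ _ _ (Hq q)); [|exists y; [exact: yim|]].
by rewrite /= in_itv.
Qed.

(** From [x <= (q-1)/q] follows [ln (q-1) - ln x >= ln q], and the remaining term [-(1-x) ln (1-x)]
    is positive. *)
Lemma Hq_gt (K : realType) (q : nat) (x : K) : (1 < q)%N ->
  0 < x <= 1 - q%:R^-1 -> x < Hq q x.
Proof.
move=> q1 /andP[x0 xq]; have q1' : 1 < q%:R :> K by rewrite ltr1n.
have q0 : 0 < q%:R :> K by rewrite (lt_trans _ q1').
have lq : 0 < ln (q%:R : K) by rewrite ln_gt0.
have x1 : x < 1 by rewrite (le_lt_trans xq)// gtrDl oppr_lt0 invr_gt0.
rewrite (_ : Hq q x = (x * (ln (q%:R - 1) - ln x)
    - (1 - x) * ln (1 - x)) / ln q%:R); last by rewrite /Hq /logq; ring.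
rewrite ltr_pdivlMr//.
have h1 : x * ln q%:R <= x * (ln (q%:R - 1) - ln x).
  rewrite ler_pM2l// -ln_div ?posrE ?subr_gt0//.
  rewrite ler_ln ?posrE ?divr_gt0 ?subr_gt0//.
  rewrite ler_pdivlMr// (le_trans (_ : _ <= q%:R * (1 - q%:R^-1)))//.
    by rewrite ler_pM2l.
  by rewrite mulrBr mulr1 mulfV// gt_eqF.
have h2 : (1 - x) * ln (1 - x) < 0.
  by rewrite nmulr_llt0 ?subr_gt0// ln_lt0// subr_gt0 x1 gtrDl oppr_lt0.
lra.
Qed.

(** * The exponent in the cases [T = 0] and [T > 0] *)

Theorem proposition6 (K : realType) (q : nat) (hq : prime_power q)
    (k t l : nat -> nat) (R T L : K) (gamma : nat) (hgamma : (2 < gamma)%N)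
    (hparam : \forall n \near \oo,
       [/\ (0 < l n)%N, (k n + l n <= n)%N & (t n <= n)%N])
    (hR : (fun n => (k n)%:R / n%:R : K) @ \oo --> R)
    (hT : (fun n => (t n)%:R / n%:R : K) @ \oo --> T)
    (hTR : T = Hq_inv q (1 - R))
    (hL : (fun n => (l n)%:R / n%:R : K) @ \oo --> L)
    (hLT : L = T / gamma%:R)
    (cost : nat -> K) (hcost0 : \forall n \near \oo, 0 < cost n)
    (hcost : cost =O_\oo (fun n =>
       (prange_success q n (k n) (t n) (l n))^-1
       * prange_iteration_cost q n (k n) (l n))) :
  asymptotic_complexity_le q cost (prange_exponent q R T L).
Proof.
have q1 : (1 < q)%N.
  have [p [m [pp m0 ->]]] := hq.
  by rewrite -(exp1n m) ltn_exp2r// prime_gt1.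
have q1' : 1 < q%:R :> K by rewrite ltr1n.
have q0 : 0 < q%:R :> K by rewrite (lt_trans _ q1').
have lq : 0 < ln (q%:R : K) by rewrite ln_gt0.
have R0 : 0 <= R.
  by apply: cvgr_to_ge hR _; near=> n; rewrite divr_ge0.
have R1 : R <= 1.
  apply: cvgr_to_le hR _; near=> n.
  have n0 : 0 < n%:R :> K by rewrite ltr0n; near: n; exact: nbhs_infty_gt.
  have [_ kln _] : [/\ (0 < l n)%N, (k n + l n <= n)%N & (t n <= n)%N].
    by near: n.
  by rewrite ler_pdivrMr// mul1r ler_nat (leq_trans _ kln)// leq_addr.
have [|/andP[T0 T1] HT] := @Hq_invP K q (1 - R) q1.
  by rewrite subr_ge0 R1 gerBl.
rewrite -hTR in T0 T1 HT.
have g0 : 0 < gamma%:R :> K by rewrite ltr0n (leq_trans _ hgamma).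
have L0 : 0 <= L by rewrite hLT divr_ge0// ltW.
have min0 : 0 <= Num.min (Hbin q (R + L) R) L.
  by rewrite le_min L0 andbT Hbin_ge0// R0 lerDl.
suff : asymptotic_complexity_le q cost
    (Hbin q 1 (R + L) - Hbin q (1 - T) R - Hbin q T L).
  by move/le_trans; apply; rewrite lee_fin lerDl.
move: T0; rewrite le_eqVlt => /predU1P[T0|T0].
  have R1' : R = 1 by move: HT; rewrite -T0 Hq0 => /esym/subr0_eq.
  have L0' : L = 0 by rewrite hLT -T0 mul0r.
  apply: (@prange_complexity_le K q k t l cost
    (fun n => (q%:R ^+ t n)^-1)) => //.
    near=> n.
    have [l0 kln tn] : [/\ (0 < l n)%N, (k n + l n <= n)%N & (t n <= n)%N].
      by near: n.
    by rewrite invr_gt0 exprn_gt0//= prange_success_ge_qt// ltnW.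
  have -> : - (Hbin q 1 (R + L) - Hbin q (1 - T) R - Hbin q T L) = - 0.
    by rewrite -T0 L0' R1' /Hbin addr0 !subr0 mul0r !subrr oppr0.
  (* The target [-0] becomes [-T], the limit of [- t n / n], which is the normalised [log_q] of
     [q^(- t n)]. *)
  rewrite T0; apply: cvg_trans (cvgN hT); apply: near_eq_cvg; near=> n.
  rewrite fctE /logq lnV ?posrE ?exprn_gt0// lnXn//= -mulr_natl.
  by field; rewrite gt_eqF//= gt_eqF// ltr0n; near: n; exact: nbhs_infty_gt.
have LT : L < T.
  rewrite hLT ltr_pdivrMr// ltr_pMr// ltr1n.
  exact: leq_trans hgamma.
(* Equivalent to [T < 1 - R = Hq q T]. *)
have RT : R < 1 - T.
  rewrite ltrBrDr -ltrBrDl -HT; apply: Hq_gt => //; exact/andP.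
pose B n : K := ('C(n - t n, k n) * 'C(t n, l n))%:R
  / ('C(n, k n + l n))%:R / q%:R.
have hn1 : (fun n => n%:R / n%:R : K) @ \oo --> (1 : K).
  apply: cvg_near_cst; near=> n; rewrite divff// gt_eqF// ltr0n.
  by near: n; exact: nbhs_infty_gt.
have hnt : (fun n => (n - t n)%:R / n%:R : K) @ \oo --> 1 - T.
  apply: cvg_trans (cvgB hn1 hT); apply: near_eq_cvg; near=> n.
  have [_ _ tn] : [/\ (0 < l n)%N, (k n + l n <= n)%N & (t n <= n)%N].
    by near: n.
  by rewrite !fctE natrB// mulrBl.
have hkl : (fun n => (k n + l n)%:R / n%:R : K) @ \oo --> R + L.
  apply: cvg_trans (cvgD hR hL); apply: near_eq_cvg; near=> n.
  by rewrite !fctE natrD mulrDl.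
(* Separating the ratios at the midpoint of [F] and [G] turns [L < T] and [R < 1 - T] into eventual
   inequalities that keep the binomials in [B] positive. *)
have lt_ratio (f g : nat -> nat) (F G : K) : F < G ->
    (fun n => (f n)%:R / n%:R : K) @ \oo --> F ->
    (fun n => (g n)%:R / n%:R : K) @ \oo --> G ->
    \forall n \near \oo, (f n <= g n)%N.
  move=> /midf_lt[h1 h2] hf hg; near=> n.
  have n0 : 0 < n%:R :> K by rewrite ltr0n; near: n; exact: nbhs_infty_gt.
  rewrite -(ler_nat K) -(ler_pM2r (x := n%:R^-1)) ?invr_gt0//.
  apply: (@le_trans _ _ ((F + G) / 2%:R)); near: n.
    exact: cvgr_le hf _ h1.
  exact: cvgr_ge hg _ h2.
have near_lt := lt_ratio _ _ _ _ LT hL hT.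
have near_knt := lt_ratio _ _ _ _ RT hR hnt.
apply: (@prange_complexity_le K q k t l cost B) => //.
  near=> n.
  have [l0 kln tn] : [/\ (0 < l n)%N, (k n + l n <= n)%N & (t n <= n)%N].
    by near: n.
  have ltn : (l n <= t n)%N by near: n.
  have kntn : (k n <= n - t n)%N by near: n.
  rewrite prange_success_ge_term ?(ltnW q1)// andbT /B.
  by rewrite !divr_gt0// ltr0n ?muln_gt0 ?bin_gt0 ?ltn ?kntn.
have hC1 : (fun n => n%:R^-1 * logq q ('C(n, k n + l n)%:R : K)) @ \oo
    --> Hbin q 1 (R + L).
  apply: cvg_logq_bin => //; near=> n.
  by have [] : [/\ (0 < l n)%N, (k n + l n <= n)%N & (t n <= n)%N] by near: n.
have hC2 := cvg_logq_bin (q := q) near_knt hnt hR.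
have hC3 := cvg_logq_bin (q := q) near_lt hT hL.
(* The extra [- 0] is the limit of [-1/n], the contribution of the factor [1/q] in [B]. *)
have -> : - (Hbin q 1 (R + L) - Hbin q (1 - T) R - Hbin q T L) =
    Hbin q (1 - T) R + Hbin q T L - Hbin q 1 (R + L) - 0 by ring.
apply: cvg_trans (cvgB (cvgB (cvgD hC2 hC3) hC1) (@cvg_invn K)).
apply: near_eq_cvg; near=> n.
have [l0 kln tn] : [/\ (0 < l n)%N, (k n + l n <= n)%N & (t n <= n)%N].
  by near: n.
have ltn : (l n <= t n)%N by near: n.
have kntn : (k n <= n - t n)%N by near: n.
have c1 : 0 < 'C(n, k n + l n)%:R :> K by rewrite ltr0n bin_gt0.
have c2 : 0 < 'C(n - t n, k n)%:R :> K by rewrite ltr0n bin_gt0.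
have c3 : 0 < 'C(t n, l n)%:R :> K by rewrite ltr0n bin_gt0.
rewrite !fctE /= /B /logq natrM !ln_div ?posrE ?divr_gt0 ?mulr_gt0//.
rewrite lnM ?posrE//; field; rewrite gt_eqF//= gt_eqF// ltr0n.
by near: n; exact: nbhs_infty_gt.
Unshelve. all: by end_near. Qed.
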